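(* Let $\delta\ge3$ and let $\overrightarrow{\mathcal K}$ be a Ramsey class whose members are either all ordered metric spaces with distances in $\{1,\dots,\delta-1\}$, or all ordered metric spaces with distances in $\{1,\dots,\delta-1\}$ equipped with a unary predicate $B$ determining the bipartition. Then the class $\overrightarrow{\mathcal K}^\ominus=\{\overrightarrow{\mathbf M}^\ominus:\overrightarrow{\mathbf M}\in\overrightarrow{\mathcal K}\}$ of all antipodal expansions of members of $\overrightarrow{\mathcal K}$ is Ramsey.
   Context: For $\mathbf M=(M,d)$ with distances at most $\delta-1$, its antipodal extension is $\mathbf M^\ominus=(M\times\{0,1\},d')$ with $d'((u,i),(v,i))=d(u,v)$ and $d'((u,i),(v,1-i))=\delta-d(u,v)$ for $u,v\in M$, $i\in\{0,1\}$ (so $d'((u,0),(u,1))=\delta$). For an ordered space $\overrightarrow{\mathbf M}=(M,d,\le)$, $\overrightarrow{\mathbf M}^\ominus$ is $\mathbf M^\ominus$ with order $(u,i)\le(v,j)$ iff $i<j$, or $i=j$ and $u\le v$. For an ordered bipartite space $(M,d,\le,B)$, where $B$ is a unary predicate such that $d(u,v)$ is even iff $u,v$ are both in $B$ or both outside $B$, the antipodal extension additionally has the predicate $B^\ominus$ with $(v,0)\in B^\ominus$ iff $v\in B$, and $(v,1)\in B^\ominus$ iff $v\in B$ when $\delta$ is even, iff $v\notin B$ when $\delta$ is odd. A class $\mathcal C$ is Ramsey if for all $\mathbf A,\mathbf B\in\mathcal C$ and $k\ge1$ there is $\mathbf C\in\mathcal C$ such that for every $k$-colouring of the substructures of $\mathbf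 C$ isomorphic to $\mathbf A$ some substructure of $\mathbf C$ isomorphic to $\mathbf B$ has all its copies of $\mathbf A$ of one colour. *)

(* Defs.v *)
From mathcomp Require Import all_boot.
From mathcomp Require Import boolp classical_sets.

Set Implicit Arguments.
Unset Strict Implicit.
Unset Printing Implicit Defensive.

Local Open Scope classical_set_scope.

Variant language := Ordered | OrderedBipartite.

Definition unary_symbol (L : language) : Type :=
  match L with Ordered => void | OrderedBipartite => unit end.

(* No axiom is imposed on the structures themselves: the antipodal extension of
   a metric space need not satisfy the triangle inequality, so Ramsey classes
   are classes of arbitrary structures in the language.  For [L = Ordered],
   [upred] is a function out of [void] and carries no data. *)
Record ostruct (L : language) := OStruct {
  carrier :> Type;
  dist : carrier -> carrier -> nat;
  ole : rel carrier;
  upred : unary_symbol L -> pred carrier }.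

Arguments dist {L o} u v.
Arguments ole {L o} u v.
Arguments upred {L o} p u.

Section Structures.
Variable L : language.
Implicit Types M N A B C : ostruct L.

Definition isomorphism M N (f : M -> N) : Prop :=
  [/\ bijective f,
      forall u v, dist (f u) (f v) = dist u v,
      forall u v, ole (f u) (f v) = ole u v
    & forall p u, upred p (f u) = upred p u].

Definition isomorphic M N : Prop := exists f : M -> N, isomorphism f.

Definition substructure M (S : set M) : ostruct L :=
  @OStruct L (set_type S)
    (fun u v => dist (val u) (val v))
    (fun u v => ole (val u) (val v))
    (fun p u => upred p (val u)).

Definition copy A C (S : set C) : Prop := isomorphic A (substructure S).

Definition Ramsey (K : ostruct L -> Prop) : Prop :=
  forall A B, K A -> K B -> forall k : nat, 1 <= k ->
  exists2 C, K C &
    forall chi : {S : set C | copy A S} -> 'I_k,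
    exists2 S : set C, copy B S &
      exists c : 'I_k, forall S' : {S : set C | copy A S},
        sval S' `<=` S -> chi S' = c.

(* An ordered metric space with distances in {1, ..., delta - 1}; the last
   clause, which is vacuous for [L = Ordered], says that the unary predicate
   determines the bipartition. *)
Record ordered_metric_space (delta : nat) M : Prop := {
  dist_eq0 : forall u v : M, dist u v = 0 <-> u = v;
  dist_sym : forall u v : M, dist u v = dist v u;
  dist_triangle : forall u v w : M, dist u w <= dist u v + dist v w;
  dist_bound : forall u v : M, dist u v <= delta - 1;
  ole_refl : reflexive (@ole L M);
  ole_anti : antisymmetric (@ole L M);
  ole_trans : transitive (@ole L M);
  ole_total : total (@ole L M);
  bipartition : forall (p : unary_symbol L) (u v : M),
    ~~ odd (dist u v) <-> upred p u = upred p v }.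

Definition antipodal (delta : nat) M : ostruct L :=
  @OStruct L (M * bool)%type
    (fun x y => if x.2 == y.2 then dist x.1 y.1 else delta - dist x.1 y.1)
    (fun x y => (x.2 < y.2) || (x.2 == y.2) && ole x.1 y.1)
    (fun p x => if x.2 && odd delta then ~~ upred p x.1 else upred p x.1).

Definition antipodal_class (delta : nat) (K : ostruct L -> Prop) :
    ostruct L -> Prop :=
  fun N => exists2 M, K M & N = antipodal delta M.

End Structures.

(* Main.v *)
(** In the antipodal extension of a space with distances below [delta], the
    points at distance [delta] from a point are exactly its antipode, and a
    point lies below its antipode exactly when its level is 0.  An embedding of
    one extension into another therefore commutes with antipodes and preserves
    the levels, so it is induced by an embedding of the base spaces.  Hence
    [S |-> S x {0,1}] is an inclusion-preserving bijection from the copies of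
    [A] in [C] onto the copies of the extension of [A] in the extension of [C],
    and the Ramsey property carries over. *)
Require Import Defs.
From mathcomp Require Import all_boot.
From mathcomp Require Import boolp classical_sets functions.

Set Implicit Arguments.
Unset Strict Implicit.
Unset Printing Implicit Defensive.

Local Open Scope classical_set_scope.

Section Embeddings.
Variable L : language.
Implicit Types A C : ostruct L.

Definition embedding A C (e : A -> C) : Prop :=
  [/\ injective e,
      forall u v, dist (e u) (e v) = dist u v,
      forall u v, ole (e u) (e v) = ole u v
    & forall p u, upred p (e u) = upred p u].

Lemma copy_range A C (e : A -> C) : embedding e -> copy A (range e).
Proof.
case=> e_inj e_dist e_ole e_upred.
have e_range u : e u \in range e by rewrite inE; exists u.
exists (fun u => exist _ (e u) (e_range u)); split=> //.
rewrite -setTT_bijective; split=> // [u v _ _ [/e_inj]//|[x x_range] _].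
by have [u _ eux] := set_mem x_range; exists u => //; apply: val_inj.
Qed.

Lemma copyP A C (S : set C) :
  copy A S <-> exists2 e : A -> C, embedding e & S = range e.
Proof.
split=> [[f [f_bij f_dist f_ole f_upred]]|[e e_emb ->]]; last first.
  exact: copy_range.
exists (val \o f); first by split=> // u v /val_inj; apply: (bij_inj f_bij).
have [g _ gK] := f_bij.
apply/seteqP; split=> [x Sx|_ [u _ <-]]; last exact: set_mem (valP (f u)).
by exists (g (exist _ x (mem_set Sx))); rewrite //= gK.
Qed.

End Embeddings.

Lemma Ramsey_image (L L' : language) (F : ostruct L -> ostruct L')
    (lift : forall C : ostruct L, set C -> set (F C)) (K : ostruct L -> Prop) :
    (forall (A C : ostruct L) (S : set C), K A -> K C ->
       copy A S -> copy (F A) (lift C S)) ->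
    (forall (A C : ostruct L) (T : set (F C)), K A -> K C ->
       copy (F A) T -> exists2 S : set C, copy A S & T = lift C S) ->
    (forall (C : ostruct L) (S S' : set C), K C ->
       lift C S `<=` lift C S' -> S `<=` S') ->
  Ramsey K -> Ramsey (fun N => exists2 M, K M & N = F M).
Proof.
move=> copy_lift lift_copy lift_subset K_Ramsey.
move=> _ _ [A KA ->] [B KB ->] k k_gt0.
have [C KC C_Ramsey] := K_Ramsey A B KA KB k k_gt0.
exists (F C) => [|chi]; first by exists C.
pose chi_lift (S : {S : set C | copy A S}) : 'I_k :=
  chi (exist _ _ (copy_lift _ _ _ KA KC (svalP S))).
have [S B_S [c chi_liftE]] := C_Ramsey chi_lift.
exists (lift C S); first exact: (copy_lift B).
exists c => -[T FA_T] /=.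
have [S' A_S' T_lift] := lift_copy _ _ _ KA KC FA_T.
rewrite {1}T_lift => /(lift_subset _ _ _ KC) subS'S.
rewrite -(chi_liftE (exist _ S' A_S') subS'S).
by congr chi; apply: eq_exist.
Qed.

Section Antipodal.
Variables (L : language) (delta : nat).
Implicit Types A C : ostruct L.

Definition antipode C (x : antipodal delta C) : antipodal delta C :=
  (x.1, ~~ x.2).

Definition antipodal_map A C (h : A -> C) (x : antipodal delta A) :
    antipodal delta C :=
  (h x.1, x.2).

Definition antipodal_set C (S : set C) : set (antipodal delta C) :=
  fst @^-1` S.

Lemma antipodal_set_subset C (S S' : set C) :
  antipodal_set S `<=` antipodal_set S' -> S `<=` S'.
Proof. by move=> subSS' u; apply: (subSS' (u, false)). Qed.

Lemma range_antipodal_map A C (h : A -> C) :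
  range (antipodal_map h) = antipodal_set (range h).
Proof.
apply/seteqP; split=> [_ [[u i] _ <-]|[w i] [u _ /= <-]]; first by exists u.
by exists (u, i).
Qed.

Lemma embedding_antipodal_map A C (h : A -> C) :
  embedding (antipodal_map h) <-> embedding h.
Proof.
split=> -[h_inj h_dist h_ole h_upred]; split.
- move=> u v huv; suff [] : (u, false) = (v, false) by [].
  by apply: h_inj; rewrite /antipodal_map huv.
- by move=> u v; apply: (h_dist (u, false) (v, false)).
- by move=> u v; apply: (h_ole (u, false) (v, false)).
- by move=> p u; apply: (h_upred p (u, false)).
- by move=> [u i] [v j] [/h_inj -> ->].
- by move=> x y /=; rewrite h_dist.
- by move=> x y /=; rewrite h_ole.
- by move=> p x /=; rewrite h_upred.
Qed.

Lemma copy_antipodal_set A C (S : set C) :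
  copy A S -> copy (antipodal delta A) (antipodal_set S).
Proof.
case/copyP=> h h_emb ->; rewrite -range_antipodal_map.
exact/copy_range/embedding_antipodal_map.
Qed.

Lemma ole_antipode C (x : antipodal delta C) : ole x (antipode x) = ~~ x.2.
Proof. by case: x => u []. Qed.

Lemma dist_antipode C (x : antipodal delta C) :
  dist x.1 x.1 = 0 -> dist x (antipode x) = delta.
Proof. by case: x => u [] /= ->; rewrite subn0. Qed.

Lemma antipodal_dist_eq C (x y : antipodal delta C) :
    dist x.1 y.1 < delta -> (dist x.1 y.1 = 0 -> x.1 = y.1) ->
  dist x y = delta -> y = antipode x.
Proof.
case: x y => [u i] [v j] /= lt_uv eq_uv; case: eqVneq => [_ duv|neq_ij duv].
  by rewrite duv ltnn in lt_uv.
rewrite /antipode /= eq_uv; first by case: i j neq_ij {duv} => [] [].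
by rewrite -(subKn (ltnW lt_uv)) duv subnn.
Qed.

Section InducedEmbeddings.
Variables A C : ostruct L.
Hypothesis dist_self : forall u : A, dist u u = 0.
Hypothesis dist_eq0_eq : forall u v : C, dist u v = 0 -> u = v.
Hypothesis dist_lt : forall u v : C, dist u v < delta.

Lemma embedding_antipode (e : antipodal delta A -> antipodal delta C) x :
  embedding e -> e (antipode x) = antipode (e x).
Proof.
case=> _ e_dist _ _; apply: antipodal_dist_eq => //; first exact: dist_eq0_eq.
by rewrite e_dist dist_antipode.
Qed.

Lemma embedding_level (e : antipodal delta A -> antipodal delta C) x :
  embedding e -> (e x).2 = x.2.
Proof.
move=> e_emb; have [_ _ e_ole _] := e_emb; apply: negb_inj.
by rewrite -!ole_antipode -embedding_antipode // e_ole.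
Qed.

Lemma embedding_antipodalP (e : antipodal delta A -> antipodal delta C) :
  embedding e <-> exists2 h : A -> C, embedding h & e = antipodal_map h.
Proof.
split=> [e_emb|[h h_emb ->]]; last exact/embedding_antipodal_map.
pose h u := (e (u, false)).1.
suff eE : e = antipodal_map h.
  by exists h => //; apply/embedding_antipodal_map; rewrite -eE.
apply/funext => -[u i].
rewrite [LHS]surjective_pairing embedding_level //; case: i => //.
by rewrite -[(u, true)]/(antipode (u, false)) embedding_antipode.
Qed.

Lemma copy_antipodal_inv (T : set (antipodal delta C)) :
  copy (antipodal delta A) T ->
  exists2 S : set C, copy A S & T = antipodal_set S.
Proof.
case/copyP=> _ /embedding_antipodalP[h h_emb ->] ->.
by exists (range h); [exact: copy_range | exact: range_antipodal_map].
Qed.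

End InducedEmbeddings.
End Antipodal.

Theorem theorem7p4 (delta : nat) (L : language) (K : ostruct L -> Prop)
    (hdelta : 3 <= delta)
    (hK : forall M : ostruct L, K M -> ordered_metric_space delta M)
    (hR : Ramsey K) :
  Ramsey (antipodal_class delta K).
Proof.
have dist_lt C : K C -> forall u v : C, dist u v < delta.
  move=> /hK C_metric u v; apply: leq_ltn_trans (dist_bound C_metric u v) _.
  by rewrite subn1 prednK // (leq_trans _ hdelta).
apply: (Ramsey_image (lift := @antipodal_set L delta)) hR.
- by move=> A C S _ _; apply: copy_antipodal_set.
- move=> A C T KA KC; apply: copy_antipodal_inv => [u|u v|].
  + exact/(dist_eq0 (hK A KA)).
  + by move/(dist_eq0 (hK C KC)).
  + exact: dist_lt.
- by move=> C S S' _; apply: antipodal_set_subset.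
Qed.
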